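(* Let $N\ge 1$, $w\in\mathbb{R}^N$, $\mathcal{C}:=\{i: w_i\ne 0\}$, let $V:\mathbb{R}^N\to\mathbb{R}$ be a quadratic polynomial (the penalty), let $\mathcal{F}\subseteq\{0,1\}^{\mathcal{C}}$ be the set of feasible core assignments, and let $\mathcal{D}\subseteq\mathbb{R}^N$ be a bounded set of directions. Consider $$\hat f(z)=w^\top z+\gamma V(z),\qquad z\in[0,1]^N,$$ where $\gamma$ is a real penalty parameter, and assume: (i) (core binarity) every local minimizer of $\hat f$ over $[0,1]^N$ has a binary core; (ii) (local repairability) $V$ is locally repairable with margin $\delta>0$ relative to the bounded direction set $\mathcal{D}$. Define $$L:=\sup\{\langle w,d\rangle : z\in[0,1]^N \text{ has infeasible binary core},\ d\in\mathcal{D}\cap T(z)\}.$$ Then, for every $\gamma>L/\delta$, every local minimizer of $\hat f$ over $[0,1]^N$ has feasible core.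
   Context: The core of $z\in[0,1]^N$ is the restriction $z_{\mathcal{C}}=(z_i)_{i\in\mathcal{C}}$. The core is binary if $z_{\mathcal{C}}\in\{0,1\}^{\mathcal{C}}$, feasible if $z_{\mathcal{C}}\in\mathcal{F}$, and infeasible binary if $z_{\mathcal{C}}\in\{0,1\}^{\mathcal{C}}\setminus\mathcal{F}$. The tangent cone of the box at $z\in[0,1]^N$ is $T(z):=\{d\in\mathbb{R}^N : z_i=0\Rightarrow d_i\ge 0,\ z_i=1\Rightarrow d_i\le 0\}$ (coordinates with $0<z_i<1$ are unrestricted). $V$ is locally repairable with margin $\delta>0$ relative to $\mathcal{D}$ if for every $z\in[0,1]^N$ with infeasible binary core there exists $d\in\mathcal{D}\cap T(z)$ with $\langle\nabla V(z),d\rangle\le-\delta$. A local minimizer of $\hat f$ over $[0,1]^N$ is a point of $[0,1]^N$ minimizing $\hat f$ among all points of $[0,1]^N$ in some neighborhood of it.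
   Formalization: The formal theorem adds γ ≥ 0 (automatic when L ≥ 0); without it the claim fails, e.g. N=1, w=1, V(z)=z²+z, F={0}, D={−1}, δ=1, γ=−1/2, where L=−1 and z=1 is an infeasible local minimizer. *)

(* Defs.v *)
From HB Require Import structures.
From mathcomp Require Export all_boot all_order all_algebra.
From mathcomp Require Export all_classical all_reals all_analysis.
Export Order.TTheory GRing.Theory Num.Theory.
Export numFieldNormedType.Exports.
Set Implicit Arguments.
Unset Strict Implicit.
Unset Printing Implicit Defensive.
Local Open Scope classical_set_scope.
Local Open Scope ring_scope.

Definition dot (R : realType) (N : nat) (u v : 'rV[R]_N) : R :=
  \sum_(i < N) u 0 i * v 0 i.

Definition box (R : realType) (N : nat) : set 'rV[R]_N :=
  [set z | forall i, 0 <= z 0 i <= 1].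

Definition tangent_cone (R : realType) (N : nat) (z : 'rV[R]_N) :
    set 'rV[R]_N :=
  [set d | forall i, (z 0 i = 0 -> 0 <= d 0 i) /\ (z 0 i = 1 -> d 0 i <= 0)].

(* Degree at most 2; the matrix Q need not be symmetric. *)
Definition quadratic_poly (R : realType) (N : nat) (V : 'rV[R]_N -> R) : Prop :=
  exists (Q : 'M[R]_N) (b : 'rV[R]_N) (c : R),
    forall z, V z = dot (z *m Q) z + dot b z + c.

Definition gradient (R : realType) (N : nat) (V : 'rV[R]_N -> R)
    (z : 'rV[R]_N) : 'rV[R]_N :=
  \row_i derive V z (delta_mx 0 i).

Definition local_minimizer (R : realType) (T : topologicalType) (A : set T)
    (f : T -> R) (z : T) : Prop :=
  A z /\ \forall y \near z, A y -> f z <= f y.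

Definition core_index (R : realType) (N : nat) (w : 'rV[R]_N) : Type :=
  {i : 'I_N | w 0 i != 0}.

Definition core (R : realType) (N : nat) (w z : 'rV[R]_N) :
    core_index w -> R :=
  fun i => z 0 (val i).

Definition binary_assignments (R : realType) (N : nat) (w : 'rV[R]_N) :
    set (core_index w -> R) :=
  [set c | forall i, c i = 0 \/ c i = 1].

Definition binary_core (R : realType) (N : nat) (w z : 'rV[R]_N) : Prop :=
  binary_assignments (core (w := w) z).

Definition feasible_core (R : realType) (N : nat) (w : 'rV[R]_N)
    (F : set (core_index w -> R)) (z : 'rV[R]_N) : Prop :=
  F (core z).

Definition infeasible_binary_core (R : realType) (N : nat) (w : 'rV[R]_N)
    (F : set (core_index w -> R)) (z : 'rV[R]_N) : Prop :=
  (binary_assignments (w := w) `\` F) (core z).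

Definition locally_repairable (R : realType) (N : nat) (w : 'rV[R]_N)
    (F : set (core_index w -> R)) (D : set 'rV[R]_N) (V : 'rV[R]_N -> R)
    (delta : R) : Prop :=
  forall z, box z -> infeasible_binary_core F z ->
    exists2 d, (D `&` tangent_cone z) d & dot (gradient V z) d <= - delta.

(* For gamma < 0 the penalty becomes a reward and large gradients of V can
   pin a minimizer at an infeasible core: take N = 1, w = 1, V z = z^2 + z,
   F = {0}, D = {-1}, delta = 1, gamma = -1/2, where repair_cost is -1.  Hence
   statements about infeasible cores need 0 <= gamma. *)
Definition penalized (R : realType) (N : nat) (w : 'rV[R]_N)
    (V : 'rV[R]_N -> R) (gamma : R) (z : 'rV[R]_N) : R :=
  dot w z + gamma * V z.

(* Extended-real supremum: it equals -oo when no admissible pair (z, d)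
   exists. *)
Definition repair_cost (R : realType) (N : nat) (w : 'rV[R]_N)
    (F : set (core_index w -> R)) (D : set 'rV[R]_N) : \bar R :=
  ereal_sup [set x | exists z d, [/\ box z, infeasible_binary_core F z,
    (D `&` tangent_cone z) d & x = (dot w d)%:E]].

(* Main.v *)
(** At an infeasible binary core, local repairability supplies a feasible
    direction [d] along which the first-order change of the penalized objective,
    [<w, d> + gamma <grad V z, d> <= L - gamma delta], is negative.  The
    objective is quadratic along the ray [z + t d], so it strictly decreases for
    small [t > 0], and [z] is not a local minimizer. *)
Require Import Defs.
From mathcomp Require Import ring lra.
Set Implicit Arguments.
Unset Strict Implicit.
Unset Printing Implicit Defensive.
Local Open Scope classical_set_scope.
Local Open Scope ring_scope.

Lemma dotE (R : realType) (N : nat) (u v : 'rV[R]_N) :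
  dot u v = (u *m v^T) 0 0.
Proof. by rewrite mxE; apply: eq_bigr => i _; rewrite mxE. Qed.

Lemma dotC (R : realType) (N : nat) (u v : 'rV[R]_N) : dot u v = dot v u.
Proof. by apply: eq_bigr => i _; rewrite mulrC. Qed.

Lemma dotDl (R : realType) (N : nat) (u v x : 'rV[R]_N) :
  dot (u + v) x = dot u x + dot v x.
Proof. by rewrite !dotE mulmxDl mxE. Qed.

Lemma dotZl (R : realType) (N : nat) (a : R) (u x : 'rV[R]_N) :
  dot (a *: u) x = a * dot u x.
Proof. by rewrite !dotE -scalemxAl mxE. Qed.

Lemma dotDr (R : realType) (N : nat) (x u v : 'rV[R]_N) :
  dot x (u + v) = dot x u + dot x v.
Proof. by rewrite dotC dotDl !(dotC x). Qed.

Lemma dotZr (R : realType) (N : nat) (a : R) (x u : 'rV[R]_N) :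
  dot x (a *: u) = a * dot x u.
Proof. by rewrite dotC dotZl (dotC x). Qed.

Lemma dot_delta_mx (R : realType) (N : nat) (g : 'rV[R]_N) (i : 'I_N) :
  dot g (delta_mx 0 i) = g 0 i.
Proof.
rewrite /dot (bigD1 i) //= mxE !eqxx mulr1 big1 ?addr0 // => j ji.
by rewrite mxE (negbTE ji) andbF mulr0.
Qed.

Lemma dot_mulmx_tr (R : realType) (N : nat) (Q : 'M[R]_N) (u v : 'rV[R]_N) :
  dot (u *m Q) v = dot (v *m Q^T) u.
Proof. by rewrite [RHS]dotC !dotE trmx_mul trmxK mulmxA. Qed.

(** The filter is left arbitrary so that one statement serves both the punctured neighborhoods of 0
    (derivatives) and the right neighborhoods (rays into the box). *)
Lemma cvg_affine0 (R : realType) (a b : R) (F : set_system R)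
    {FF : Filter F} :
  F --> (0 : R) -> a + t * b @[t --> F] --> a.
Proof.
move=> F0; rewrite -[X in _ --> X]addr0 -[X in _ --> _ + X](mul0r b).
by apply: cvgD; [exact: cvg_cst | apply: cvgM => //; exact: cvg_cst].
Qed.

(** For [t != 0] the difference quotient is exactly [a + t * c], which tends to [a]. *)
Lemma derive_quadratic_expansion (R : realType) (N : nat) (V : 'rV[R]_N -> R)
    (z d : 'rV[R]_N) (a c : R) :
  (forall t, V (z + t *: d) = V z + t * a + t ^+ 2 * c) ->
  derive V z d = a.
Proof.
move=> VE; apply: cvg_lim => //.
have : a + t * c @[t --> (0 : R)^'] --> a.
  by apply: cvg_affine0; exact: cvg_within.
apply: cvg_trans; apply: near_eq_cvg; near=> t.
rewrite /= (addrC _ z) VE; have t0 : t != 0 by near: t; exact: nbhs_dnbhs_neq.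
by rewrite /GRing.scale /=; field.
Unshelve. all: by end_near. Qed.

Lemma quadratic_poly_expansion (R : realType) (N : nat) (V : 'rV[R]_N -> R) :
  quadratic_poly V -> forall z d, exists c, forall t,
    V (z + t *: d) = V z + t * dot (gradient V z) d + t ^+ 2 * c.
Proof.
move=> [Q [b [c0 VE]]] z.
(* Since [Q] need not be symmetric, both cross terms of the form at [z + t *: d] count:
   [dot (z *m Q) d] and [dot (d *m Q) z], the latter moved onto [d] by transposing [Q]. *)
pose g := z *m Q + z *m Q^T + b.
have expand d t :
    V (z + t *: d) = V z + t * dot g d + t ^+ 2 * dot (d *m Q) d.
  rewrite !VE mulmxDl -scalemxAl !(dotDl, dotDr, dotZl, dotZr).
  by rewrite (dot_mulmx_tr Q d z); ring.
have -> : gradient V z = g.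
  (* The expansion along the [i]-th basis vector identifies the [i]-th partial derivative. *)
  apply/rowP => i; rewrite mxE -(dot_delta_mx g i).
  exact: derive_quadratic_expansion (expand _).
by move=> d; exists (dot (d *m Q) d).
Qed.

(** Each of the finitely many bounds holds for small [t > 0]: an active one by the sign that the
    tangent cone imposes on [d], an inactive one by continuity. *)
Lemma box_tangent_near (R : realType) (N : nat) (z d : 'rV[R]_N) :
  box z -> tangent_cone z d ->
  \forall t \near (0 : R)^'+, box (z + t *: d).
Proof.
move=> zbox zd; apply: filter_forall => i.
have /andP[z0 z1] := zbox i; have [d0 d1] := zd i.
have cvgi : z 0 i + t * d 0 i @[t --> (0 : R)^'+] --> z 0 i.
  by apply: cvg_affine0; exact: cvg_within.
have lower : \forall t \near (0 : R)^'+, 0 <= z 0 i + t * d 0 i.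
  have [zi|zi] := eqVneq (z 0 i) 0.
    near=> t; rewrite zi add0r; apply: mulr_ge0; last exact: d0.
    by apply: ltW; near: t; exact: nbhs_right_gt.
  by apply: (cvgr_ge _ cvgi); rewrite lt0r zi.
have upper : \forall t \near (0 : R)^'+, z 0 i + t * d 0 i <= 1.
  have [zi|zi] := eqVneq (z 0 i) 1.
    near=> t; rewrite zi gerDl; apply: mulr_ge0_le0; last exact: d1.
    by apply: ltW; near: t; exact: nbhs_right_gt.
  by apply: (cvgr_le _ cvgi); rewrite lt_neqAle zi.
by near=> t; rewrite !mxE; apply/andP; split; near: t.
Unshelve. all: by end_near. Qed.

(** If [s < 0], the increment [t * (s + t * c)] is negative for small [t > 0], while the ray is
    still in the box and near [z]. *)
Lemma local_minimizer_box_slope_ge0 (R : realType) (N : nat)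
    (f : 'rV[R]_N -> R) (z d : 'rV[R]_N) (s c : R) :
  local_minimizer (@box R N) f z -> tangent_cone z d ->
  (forall t, f (z + t *: d) = f z + t * s + t ^+ 2 * c) -> 0 <= s.
Proof.
move=> [zbox zmin] zd fE; rewrite leNgt; apply/negP => s_lt0.
have ray : z + t *: d @[t --> (0 : R)^'+] --> z.
  rewrite -{2}(addr0 z) -(scale0r d); apply: cvgD; first exact: cvg_cst.
  by apply: cvgZ; [exact: cvg_within | exact: cvg_cst].
have slope : s + t * c @[t --> (0 : R)^'+] --> s.
  by apply: cvg_affine0; exact: cvg_within.
suff : \forall t \near (0 : R)^'+, False by move=> /filter_ex[].
near=> t.
have t_gt0 : 0 < t by near: t; exact: nbhs_right_gt.
have : f z <= f (z + t *: d).
  have tbox : box (z + t *: d) by near: t; exact: box_tangent_near.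
  by move: tbox; near: t; exact: ray zmin.
have -> : f (z + t *: d) = f z + t * (s + t * c) by rewrite fE; ring.
rewrite lerDl pmulr_rge0 // leNgt => /negP; apply.
by near: t; exact: (cvgr_lt _ slope).
Unshelve. all: by end_near. Qed.

Theorem theorem2p7 (R : realType) (N : nat) (hN : (1 <= N)%N)
    (w : 'rV[R]_N) (V : 'rV[R]_N -> R) (hV : quadratic_poly V)
    (F : set (core_index w -> R)) (hF : F `<=` binary_assignments (w := w))
    (D : set 'rV[R]_N) (hD : bounded_set D)
    (delta : R) (hdelta : 0 < delta)
    (hrep : locally_repairable F D V delta)
    (gamma : R) (hgamma0 : 0 <= gamma)
    (hcore : forall z, local_minimizer (@box R N) (penalized w V gamma) z ->
       binary_core w z)
    (hgamma : (repair_cost F D / delta%:E < gamma%:E)%E) :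
  forall z, local_minimizer (@box R N) (penalized w V gamma) z ->
    feasible_core F z.
Proof.
move=> z zmin; apply: contrapT => nF.
have zinf : infeasible_binary_core F z by split => //; exact: hcore.
have zbox : box z by case: zmin.
have [d Dd gradd] := hrep z zbox zinf.
have wd_lt : dot w d < gamma * delta.
  (* The supremum is an extended real, so [delta] is cleared there; the pair [(z, d)] then bounds it
     below by the real [dot w d]. *)
  move: hgamma; rewrite inver gt_eqF // lte_pdivrMr // -EFinM => hgamma.
  rewrite -lte_fin; apply: le_lt_trans hgamma.
  by apply: ereal_sup_ubound; exists z, d.
have [c VE] := quadratic_poly_expansion hV z d.
have : 0 <= dot w d + gamma * dot (gradient V z) d.
  apply: (local_minimizer_box_slope_ge0 (c := gamma * c) zmin Dd.2) => t.
  by rewrite /penalized VE dotDr dotZr; ring.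
(* As [0 <= gamma], the repair margin scales to [gamma * dot (gradient V z) d <= - (gamma * delta)],
   so the slope is negative by [wd_lt]. *)
have := ler_wpM2l hgamma0 gradd; rewrite mulrN; lra.
Qed.
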